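(* Let $F$ be a field, $n\ge 1$, let $\mathcal{C}\subseteq M_n(F)$ be a similarity class with (common) minimal polynomial $\mu$, and let $\varnothing\neq S\subseteq\mathcal{C}$. For $a\in F$ with $x-a\mid\mu$ put $f_a=\mu/(x-a)\in F[x]$. (1) If $S$ is a core set, then for every $a\in F$ satisfying $x-a\mid\mu$ we have $\sum_{A\in S}\operatorname{Im} f_a(A)=F^n$. (2) When all irreducible factors of $\mu$ over $F$ are linear, the converse also holds: if $\sum_{A\in S}\operatorname{Im} f_a(A)=F^n$ for every $a\in F$ satisfying $x-a\mid\mu$, then $S$ is a core set.
   Context: $M_n(F)$ is the ring of $n\times n$ matrices over $F$; a similarity class is an orbit of $M_n(F)$ under conjugation by $\mathrm{GL}(n,F)$. $F^n$ is the space of column vectors, $\operatorname{Im}B$ is the image of $F^n\to F^n$, $v\mapsto Bv$, and $\sum$ denotes the sum of subspaces. In $M_n(F)[x]$ the indeterminate $x$ commutes with all coefficients, and $F[x]\subseteq M_n(F)[x]$ via scalar matrices. Evaluation is with $x$ to the right of the coefficients: for $f=\sum_k B_kx^k$ and $A\in M_n(F)$, $f(A)=\sum_k B_kA^k$. For $S\subseteq M_n(F)$, $N(S)=\{f\in M_n(F)[x] : f(A)=0\ \text{for all } A\in S\}$. $S$ is a core set if $N(S)$ is a two-sided ideal of $M_n(F)[x]$; otherwise it is a non-core set. *)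

(* Defs.v *)
From HB Require Import structures.
From mathcomp Require Import all_boot all_order all_algebra.
From mathcomp Require Import classical_sets.

Set Implicit Arguments.
Unset Strict Implicit.
Unset Printing Implicit Defensive.

Import GRing.Theory.
Local Open Scope ring_scope.
Local Open Scope classical_set_scope.

Definition similarity_class (F : fieldType) (n : nat) (A : 'M[F]_n) :
    set 'M[F]_n :=
  [set B | exists2 P : 'M[F]_n, P \in unitmx & B = P *m A *m invmx P].

Definition two_sided_ideal (R : pzRingType) (I : set R) : Prop :=
  [/\ I 0,
      forall f g, I f -> I g -> I (f - g),
      forall h f, I f -> I (h * f) &
      forall f h, I f -> I (f * h)].

(* [horner] keeps coefficients on the left: for f = \sum_k B_k 'X^k over the
   noncommutative ring of matrices, f.[A] = \sum_k B_k * A ^+ k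
   (lemma [horner_coef]). *)
Definition null_polys (F : fieldType) (n : nat) (S : set 'M[F]_n.+1) :
    set {poly 'M[F]_n.+1} :=
  [set f | forall A, S A -> f.[A] = 0].

Definition core_set (F : fieldType) (n : nat) (S : set 'M[F]_n.+1) : Prop :=
  two_sided_ideal (null_polys S).

Definition col_image (F : fieldType) (n : nat) (B : 'M[F]_n) : set 'cV[F]_n :=
  range (fun v : 'cV[F]_n => B *m v).

(* The sum of a possibly infinite family of subspaces W i, i in D: all finite
   sums of elements of its members. *)
Definition subspace_sum (V : nmodType) (I : Type) (D : set I) (W : I -> set V) :
    set V :=
  [set v | exists (m : nat) (i : 'I_m -> I) (w : 'I_m -> V),
     (forall k, D (i k) /\ W (i k) (w k)) /\ v = \sum_(k < m) w k].

(* Main.v *)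
(** (1) If W kills every f_a(A) on the left, then W f_a lies in N(S); two-sidedness
    puts W H f_a in N(S) for every constant matrix H, so W H f_a(A) = 0, and
    f_a(A) <> 0 forces W = 0. A subspace of F^n whose only left annihilator is 0
    is all of F^n.

    (2) It suffices that every f in N(S) is a multiple of mu. Write
    f q = g mu with q a divisor of mu, starting at q = mu, and split off
    q = q' (x - a). Then f q' = g f_a, and dividing g by x - a gives
    f q' = g1 mu + g0 f_a with g0 constant. Evaluation on S yields
    g0 f_a(A) = 0, hence g0 = 0 by the spanning hypothesis, and q has been
    replaced by q'. *)
Require Import Defs.
From HB Require Import structures.
From mathcomp Require Import all_boot all_order all_algebra.
From mathcomp Require Import boolp classical_sets.

Set Implicit Arguments.
Unset Strict Implicit.
Unset Printing Implicit Defensive.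

Import GRing.Theory.
Local Open Scope ring_scope.
Local Open Scope classical_set_scope.

Lemma exists_irreducible_divisor (F : fieldType) (p : {poly F}) :
  (1 < size p)%N -> exists2 q : {poly F}, irreducible_poly q & q %| p.
Proof.
have [k] := ubnP (size p); elim: k p => // k IHk p; rewrite ltnS => le_p_k p_gt1.
have p_neq0 : p != 0 by rewrite -size_poly_gt0 ltnW.
have [p_irr|p_red] := pselect (irreducible_poly p); first by exists p.
have [[q [q_neq1 q_p q_neqp]]|no_div] :=
    pselect (exists q : {poly F}, [/\ size q != 1%N, q %| p & ~~ (q %= p)]).
  have q_lt_p : (size q < size p)%N.
    by rewrite ltn_neqAle dvdp_leq // andbT dvdp_size_eqp.
  have q_gt1 : (1 < size q)%N.
    rewrite ltn_neqAle eq_sym q_neq1 size_poly_gt0.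
    by apply: contraNneq p_neq0 => q0; rewrite -dvd0p -q0.
  have [r r_irr r_q] := IHk q (leq_trans q_lt_p le_p_k) q_gt1.
  by exists r => //; apply: dvdp_trans q_p.
case: p_red; split=> // q q_neq1 q_p; apply: contrapT => /negP q_neqp.
by case: no_div; exists q.
Qed.

Lemma subspace_sumD (V : nmodType) (I : Type) (D : set I) (W : I -> set V) u v :
  subspace_sum D W u -> subspace_sum D W v -> subspace_sum D W (u + v).
Proof.
move=> [m [i [x [hx ->]]]] [p [j [y [hy ->]]]].
pose glue T (a : 'I_m -> T) (b : 'I_p -> T) k :=
  match split k with inl l => a l | inr l => b l end.
exists (m + p)%N, (glue _ i j), (glue _ x y); split.
  by move=> k; rewrite /glue; case: (split k).
by rewrite big_split_ord; congr (_ + _); apply: eq_bigr => k _;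
  rewrite /glue ?(unsplitK (inl k)) ?(unsplitK (inr k)).
Qed.

Lemma subspace_sumZ (R : pzRingType) (V : lmodType R) (I : Type) (D : set I)
    (W : I -> set V) (c : R) v :
  (forall i x, W i x -> W i (c *: x)) ->
  subspace_sum D W v -> subspace_sum D W (c *: v).
Proof.
move=> WZ [m [i [x [hx ->]]]]; exists m, i, (fun k => c *: x k).
by split=> [k|]; [case: (hx k) => ? /WZ | rewrite scaler_sumr].
Qed.

Lemma subspace_sum_mem (V : nmodType) (I : Type) (D : set I) (W : I -> set V)
    i v : D i -> W i v -> subspace_sum D W v.
Proof.
by move=> Di Wv; exists 1%N, (fun=> i), (fun=> v); rewrite big_ord1; split.
Qed.

Lemma subspace_sum_mulmx0 (F : fieldType) n (I : Type) (D : set I)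
    (B : I -> 'M[F]_n) (W : 'M[F]_n) v :
  (forall i, D i -> W *m B i = 0) ->
  subspace_sum D (fun i => col_image (B i)) v -> W *m v = 0.
Proof.
move=> WB [m [i [x [hx ->]]]]; rewrite mulmx_sumr big1 // => k _.
by have [Di [y _ <-]] := hx k; rewrite mulmxA WB // mul0mx.
Qed.

(** Since [V] is only a predicate, it is first realised as a row space: a matrix [U] of maximal rank
    whose transposed row space lies in [V] must capture all of [V]. *)
Lemma subspace_annihilator0 (F : fieldType) n (V : set 'cV[F]_n) :
  V 0 -> (forall u v, V u -> V v -> V (u + v)) ->
  (forall c v, V v -> V (c *: v)) ->
  (forall W : 'M[F]_n, (forall v, V v -> W *m v = 0) -> W = 0) ->
  V = setT.
Proof.
move=> V0 VD VZ Vann.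
pose P (U : 'M[F]_n) := forall v, (v^T <= U)%MS -> V v.
have exP : exists r, `[< exists2 U, P U & \rank U = r >].
  exists 0%N; apply/asboolP; exists 0; rewrite ?mxrank0 // => v.
  by rewrite submx0 trmx_eq0 => /eqP->.
have leP r : `[< exists2 U, P U & \rank U = r >] -> (r <= n)%N.
  by case/asboolP => U _ <-; apply: rank_leq_row.
have [r /asboolP[U PU rU] maxr] := ex_maxnP exP leP.
(* A vector of [V] outside [U] could be adjoined to it, raising the rank above the maximum. *)
have VU v : V v -> (v^T <= U)%MS.
  move=> Vv; apply: contrapT => /negP vU.
  have PUv : P (U + v^T)%MS.
    move=> x /sub_addsmxP[[y c] /= xE].
    have -> : x = (y *m U)^T + c 0 0 *: v.
      rewrite -[x]trmxK xE linearD /= [c]mx11_scalar mul_scalar_mx.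
      by rewrite [(_ *: _)^T]linearZ /= trmxK mxE eqxx mulr1n.
    by apply: VD; [apply: PU; rewrite trmxK submxMl | apply: VZ].
  have /maxr : `[< exists2 U0, P U0 & \rank U0 = \rank (U + v^T)%MS >].
    by apply/asboolP; exists (U + v^T)%MS.
  rewrite -rU leqNgt => /negP; apply.
  rewrite ltn_neqAle mxrankS ?addsmxSl // andbT.
  rewrite (mxrank_leqif_sup (addsmxSl U v^T)) addsmx_sub submx_refl /=.
  exact: vU.
(* The transposed cokernel kills [V], so it is zero and [U] has full rank. *)
have /(congr1 trmx) : (cokermx U)^T = 0.
  apply: Vann => v /VU; rewrite submxE => /eqP vU0.
  by rewrite -[v]trmxK -trmx_mul vU0 trmx0.
rewrite trmxK trmx0 => /eqP; rewrite cokermx_eq0 => U_full.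
by apply/seteqP; split=> // v _; apply: PU; apply: submx_full.
Qed.

(** For [H = delta_mx j k] the entry of [W *m H *m B] at [(i, l)] is [W i j * B k l], so one nonzero
    entry of [W] would force [B = 0]. *)
Lemma sandwich_mx_eq0 (F : fieldType) n (W B : 'M[F]_n.+1) :
  (forall H, W *m H *m B = 0) -> B != 0 -> W = 0.
Proof.
move=> WHB /eqP B_neq0; apply/matrixP=> i j; rewrite [RHS]mxE.
apply: contrapT => /eqP Wij; apply: B_neq0; apply/matrixP=> k l.
have /matrixP/(_ i l) := WHB (delta_mx j k); rewrite !mxE.
rewrite (bigD1 k) //= big1 => [|m mk]; last first.
  rewrite mxE big1 ?mul0r // => p _.
  by rewrite mxE (negPf mk) andbF mulr0.
rewrite mxE (bigD1 j) //= big1 => [|p pj]; last first.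
  by rewrite mxE (negPf pj) mulr0.
rewrite mxE !eqxx mulr1 !addr0 => /eqP.
by rewrite mulf_eq0 (negPf Wij) => /eqP.
Qed.

(** The inclusion of F[x] in the matrix polynomials via scalar matrices. *)
Local Notation central n p := (map_poly (@scalar_mx _ n.+1) p).

(** Evaluation at [A] respects a product as soon as the value of the right factor commutes with [A];
    a polynomial in [A] does. *)
Lemma horner_mul_central (F : fieldType) n (A : 'M[F]_n.+1)
    (f : {poly 'M[F]_n.+1}) (p : {poly F}) :
  (f * central n p).[A] = f.[A] * horner_mx A p.
Proof.
by rewrite hornerM_comm //; apply: comm_mx_horner.
Qed.

Lemma commr_central (F : fieldType) n (f : {poly 'M[F]_n.+1}) (p : {poly F}) :
  central n p * f = f * central n p.
Proof.
apply/polyP => k; rewrite coefM coefMr; apply: eq_bigr => i _.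
by rewrite !coef_map; apply: (esym (scalar_mxC _ _)).
Qed.

(** The value 0 of [f] commutes with [A], so evaluation splits; N(S) is thus always a left ideal. *)
Lemma null_polysMl (F : fieldType) n (S : set 'M[F]_n.+1) h f :
  null_polys S f -> null_polys S (h * f).
Proof.
move=> fS A SA; have fA := fS A SA.
by rewrite hornerM_comm ?fA ?mulr0 // /comm_poly fA mulr0 mul0r.
Qed.

Lemma core_set_of_central_multiples (F : fieldType) n (mu : {poly F})
    (S : set 'M[F]_n.+1) :
  (forall A, S A -> horner_mx A mu = 0) ->
  (forall f, null_polys S f -> exists g, f = g * central n mu) ->
  core_set S.
Proof.
move=> muS Nmu; split.
- by move=> A _; rewrite horner0.
- by move=> f g fS gS A SA; rewrite hornerD hornerN fS // gS // subr0.
- exact: null_polysMl.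
move=> f h /Nmu[g ->] A SA.
by rewrite -mulrA commr_central mulrA horner_mul_central muS // mulr0.
Qed.

Lemma null_polys_central_multiple (F : fieldType) n (mu : {poly F})
    (S : set 'M[F]_n.+1) (f : {poly 'M[F]_n.+1}) :
  (forall p : {poly F}, irreducible_poly p -> p %| mu -> size p = 2%N) ->
  mu != 0 -> (forall A, S A -> horner_mx A mu = 0) ->
  (forall a : F, 'X - a%:P %| mu ->
     subspace_sum S
       (fun A => col_image (horner_mx A (mu %/ ('X - a%:P)))) = setT) ->
  null_polys S f -> exists g, f = g * central n mu.
Proof.
move=> mu_split mu_neq0 muS full fS.
(* Divisibility of f * q by mu is carried down from q = mu to constant q, one
   linear factor at a time. *)
suff cancel k (q : {poly F}) g : (size q <= k)%N -> q %| mu ->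
    f * central n q = g * central n mu -> exists g', f = g' * central n mu.
  exact: (cancel _ mu f (leqnn _)).
elim: k q g => [|k IHk] q g le_q_k q_mu fq.
  move: le_q_k; rewrite leqn0 size_poly_eq0 => /eqP q0.
  by move: q_mu; rewrite q0 dvd0p (negPf mu_neq0).
have q_neq0 : q != 0 by apply: contraNneq mu_neq0 => q0; rewrite -dvd0p -q0.
have [q_gt1|q_le1] := ltnP 1 (size q); last first.
  have [c c_neq0 qE] : exists2 c, c != 0 & q = c%:P.
    by apply/size_poly1P; rewrite eqn_leq q_le1 size_poly_gt0.
  (* Here [q] is the nonzero constant [c], which is divided out. *)
  exists (central n (c^-1)%:P * g).
  rewrite -mulrA -fq mulrA commr_central -mulrA -rmorphM qE -polyCM mulVf //.
  by rewrite rmorph1 mulr1.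
have [p p_irr p_q] := exists_irreducible_divisor q_gt1.
have p_size := mu_split p p_irr (dvdp_trans p_q q_mu).
have [a pa] := poly2_root p_size.
have a_q : 'X - a%:P %| q by apply: dvdp_trans p_q; rewrite dvdp_XsubCl.
have a_mu : 'X - a%:P %| mu := dvdp_trans a_q q_mu.
set q' := q %/ ('X - a%:P); set fa := mu %/ ('X - a%:P).
have qE : q = q' * ('X - a%:P) by rewrite divpK.
have muE : mu = fa * ('X - a%:P) by rewrite divpK.
(* The factor x - a stays monic over the matrix ring, hence can be cancelled on the right. *)
have fq' : f * central n q' = g * central n fa.
  have /monic_rreg : central n ('X - a%:P) \is monic.
    by rewrite map_polyXsubC monicXsubC.
  by apply; rewrite -!mulrA -!rmorphM -qE -muE.
(* The remainder of [g] on right division by x - a. *)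
set g0 := g.[a%:M].
have [g1 g1E] : exists g1, g - g0%:P = g1 * ('X - a%:M%:P).
  by apply/factor_theorem; rewrite /root hornerD hornerN hornerC subrr.
have gE : g = g1 * central n ('X - a%:P) + g0%:P.
  by rewrite map_polyXsubC /= -g1E subrK.
have fq'E : f * central n q' = g1 * central n mu + g0%:P * central n fa.
  by rewrite fq' {1}gE mulrDl -mulrA -rmorphM mulrC -muE.
have g0_fa A : S A -> g0 *m horner_mx A fa = 0.
  move=> SA; have := congr1 (horner^~ A) fq'E.
  by rewrite hornerD !horner_mul_central fS // muS // hornerC mul0r mulr0 add0r.
(* By [full] each standard basis vector lies in the sum of the images, all killed by [g0]; so every
   column of [g0] vanishes. *)
have g0_eq0 : g0 = 0.
  apply/row_matrixP=> i; apply/rowP=> j.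
  have : g0 *m (delta_mx j 0 : 'cV_n.+1) = 0.
    by apply: (subspace_sum_mulmx0 g0_fa); rewrite full.
  by rewrite -colE => /colP/(_ i); rewrite !mxE.
apply: (IHk q' g1).
- have := le_q_k; rewrite qE size_Mmonic ?monicXsubC //.
    by rewrite size_XsubC addn2.
  by apply: contraNneq q_neq0 => q'0; rewrite qE q'0 mul0r.
- by apply: dvdp_trans q_mu; rewrite qE dvdp_mulr.
by rewrite fq'E g0_eq0 mul0r addr0.
Qed.

(** Polynomial evaluation commutes with conjugation, so similar matrices are annihilated by the same
    polynomials. *)
Lemma similarity_class_horner_mx_eq0 (F : fieldType) n (A B : 'M[F]_n.+1)
    (p : {poly F}) :
  similarity_class A B -> (horner_mx B p == 0) = (mxminpoly A %| p).
Proof.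
move=> [P P_unit ->]; rewrite dvd_mxminpoly horner_mx_uconj //.
apply/eqP/eqP => [PAP|->]; last by rewrite mulmx0 mul0mx.
have /(congr1 (fun M => invmx P *m M *m P)) := PAP.
by rewrite !mulmxA mulVmx // mul1mx mulmxKV // mulmx0 mul0mx.
Qed.

Theorem theorem1p7 (F : fieldType) (n : nat) (A0 : 'M[F]_n.+1)
    (C : set 'M[F]_n.+1) (hC : C = similarity_class A0)
    (mu : {poly F}) (hmu : mu = mxminpoly A0)
    (S : set 'M[F]_n.+1) (hS0 : S !=set0) (hS : S `<=` C) :
  (core_set S ->
     forall a : F, 'X - a%:P %| mu ->
       subspace_sum S
         (fun A => col_image (horner_mx A (mu %/ ('X - a%:P)))) = setT)
  /\
  ((forall p : {poly F}, irreducible_poly p -> p %| mu -> size p = 2%N) ->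
   (forall a : F, 'X - a%:P %| mu ->
       subspace_sum S
         (fun A => col_image (horner_mx A (mu %/ ('X - a%:P)))) = setT) ->
   core_set S).
Proof.
have SC A p : S A -> (horner_mx A p == 0) = (mu %| p).
  by move=> /hS; rewrite hC hmu; apply: similarity_class_horner_mx_eq0.
have mu_neq0 : mu != 0 by rewrite hmu monic_neq0 // mxminpoly_monic.
have muS A : S A -> horner_mx A mu = 0.
  by move=> SA; apply/eqP; rewrite SC.
split=> [[_ _ _ coreMr] a a_mu|mu_split full]; last first.
  by apply: (core_set_of_central_multiples muS) => f; apply: null_polys_central_multiple.
set fa := mu %/ ('X - a%:P).
have muE : mu = fa * ('X - a%:P) by rewrite divpK.
apply: subspace_annihilator0.
(* The zero vector is the empty sum; [A0] is a dummy index. *)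
- by exists 0%N, (fun=> A0), (fun=> 0); rewrite big_ord0; split=> // -[].
- by move=> u v; apply: subspace_sumD.
- move=> c v; apply: subspace_sumZ => A _ [y _ <-].
  by exists (c *: y); rewrite // -scalemxAr.
move=> W Wfa; have [A SA] := hS0.
have WfaN : null_polys S (W%:P * central n fa).
  move=> B SB; rewrite horner_mul_central hornerC; apply/matrixP=> i j.
  have /matrixP/(_ i 0) : W *m (horner_mx B fa *m delta_mx j (0 : 'I_1)) = 0.
    apply: Wfa; apply: (subspace_sum_mem SB).
    by exists (delta_mx j 0).
  by rewrite mulmxA -colE !mxE.
apply: (@sandwich_mx_eq0 _ _ W (horner_mx A fa)) => [H|].
  have /(_ A SA) := coreMr _ H%:P WfaN.
  by rewrite -mulrA commr_central mulrA -polyCM horner_mul_central hornerC.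
(* [fa] does not vanish at [A]: it is nonzero of degree one less than [mu], the minimal polynomial
   of [A]. *)
rewrite SC //; apply/negP => /dvdp_leq.
have fa_neq0 : fa != 0 by apply: contraNneq mu_neq0 => fa0; rewrite muE fa0 mul0r.
move=> /(_ fa_neq0); rewrite {1}muE.
by rewrite size_Mmonic ?monicXsubC // size_XsubC addn2 ltnn.
Qed.
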